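(* Let $\mathcal{M}=\{A(u)\mid u=(u^1,\ldots,u^m)\in\Theta\subset\mathbb{R}^m\}$ be a submanifold of $P(n)$ for which $u$ plays the role of local coordinates, let $B\in P(n)$ (not necessarily in $\mathcal{M}$), and let $J(u)=d^2(A(u),B)$. The natural gradient descent iteration for $J$, with learning rate $\eta_k$ at time $k$, is given by $$u_{k+1}=u_k-\eta_k\,G^{-1}\nabla J(u_k),$$ where $G$ is the matrix of the Riemannian metric in the coordinates $u$ at $u_k$, and the components of the gradient $\nabla J(u_k)=\left(\frac{\partial}{\partial u_k^1}J(u_k),\ldots,\frac{\partial}{\partial u_k^m}J(u_k)\right)$ satisfy $$\frac{\partial}{\partial u_k^i}J(u_k)=2\operatorname{tr}\left(B^{-\frac12}\ln\left(B^{-\frac12}A(u_k)B^{-\frac12}\right)B^{\frac12}A^{-1}(u_k)\frac{\partial}{\partial u_k^i}A(u_k)\right),\qquad i=1,2,\ldots,m.$$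
   Context: $P(n)$ is the manifold of $n\times n$ positive definite Hermitian complex matrices, an open subset of the real vector space $H(n)$ of $n\times n$ Hermitian matrices; each tangent space $T_AP(n)$ is identified with $H(n)$. The Riemannian metric on $P(n)$ is $g_A(X,Y)=\operatorname{tr}(A^{-1}XA^{-1}Y)$, and the associated geodesic distance is $d(A,B)=\|\ln(A^{-1/2}BA^{-1/2})\|_F$, where $\|\cdot\|_F$ is the Frobenius norm and $\ln$ is the Hermitian logarithm of a positive definite Hermitian matrix. In the coordinates $u$ the metric matrix is $G=(g_{ij})$ with $g_{ij}(u)=\operatorname{tr}\left(A^{-1}\frac{\partial A}{\partial u^i}A^{-1}\frac{\partial A}{\partial u^j}\right)$, where $A=A(u)$. The natural gradient descent iteration for a cost function $L(\theta)$ on a Riemannian manifold with coordinates $\theta\in\mathbb{R}^m$ and metric matrix $G(\theta)$ is the update of the coordinates by $-\eta_k$ times the Riemannian gradient $G^{-1}\nabla L$ of $L$ at $\theta_k$, where $\nabla L$ is the vector of ordinary partial derivatives of $L$. The map $u\mapsto A(u)$ is assumed smooth. *)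

(* Defs.v *)
From HB Require Import structures.
From mathcomp Require Import all_boot all_order all_algebra.
From mathcomp Require Import complex.
From mathcomp Require Import all_classical all_reals all_analysis.

Set Implicit Arguments.
Unset Strict Implicit.
Unset Printing Implicit Defensive.

Import Order.TTheory GRing.Theory Num.Theory.
Import numFieldNormedType.Exports.

Local Open Scope classical_set_scope.
Local Open Scope ring_scope.
Local Open Scope complex_scope.
Local Open Scope sesquilinear_scope.

Section HermitianMatrices.
Variables (R : realType) (n : nat).
Implicit Types A B X Y : 'M[R[i]]_n.

(* In the order of R[i], 0 < z entails that z is real. *)
Definition posdefmx A : Prop :=
  A \is hermsymmx /\
  forall x : 'cV[R[i]]_n, x != 0 -> 0 < (x ^t* *m A *m x) 0 0.

(* Functional calculus of a Hermitian matrix: f acts on the eigenvalues in a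
   unitary diagonalization, which the library writes
   A = P^-1 *m diag_mx d *m P; see herm_fun_unitary for the independence of
   the diagonalization.  The value is meaningless if A is not Hermitian. *)
Definition herm_fun (f : R -> R) A : 'M[R[i]]_n :=
  let P := spectralmx A in
  invmx P *m diag_mx (map_mx (fun z => (f (complex.Re z))%:C)
                             (spectral_diag A)) *m P.

Definition herm_sqrt A := herm_fun Num.sqrt A.
Definition herm_ln A := herm_fun (@ln R) A.

Definition frob_norm X : R :=
  Num.sqrt (\sum_i \sum_j Normc.normc (X i j) ^+ 2).

Definition geodesic_dist A B : R :=
  frob_norm (herm_ln (invmx (herm_sqrt A) *m B *m invmx (herm_sqrt A))).

(* The trace is a real number when A is positive definite and X, Y are
   Hermitian; complex.Re only brings it from R[i] to R. *)
Definition riem_metric A X Y : R :=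
  complex.Re (\tr (invmx A *m X *m invmx A *m Y)).

Lemma diag_mx_intertwine (f : R -> R) (e : 'rV[R[i]]_n) (d : 'rV[R]_n) X :
  diag_mx e *m X = X *m diag_mx (map_mx (real_complex R) d) ->
  diag_mx (map_mx (fun z => (f (complex.Re z))%:C) e) *m X =
  X *m diag_mx (map_mx (fun x => (f x)%:C) d).
Proof.
move=> /matrixP eX; apply/matrixP => i j; move: (eX i j).
rewrite !mul_diag_mx !mul_mx_diag !mxE => eXij.
have [X0|X0] := eqVneq (X i j) 0; first by rewrite X0 mulr0 mul0r.
have -> : e 0 i = (d 0 j)%:C by apply: (mulIf X0); rewrite eXij mulrC.
by rewrite mulrC.
Qed.

Lemma herm_fun_unitary (f : R -> R) A (U : 'M[R[i]]_n) (d : 'rV[R]_n) :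
  U \is unitarymx -> A = invmx U *m diag_mx (map_mx (real_complex R) d) *m U ->
  herm_fun f A = invmx U *m diag_mx (map_mx (fun x => (f x)%:C) d) *m U.
Proof.
move=> Uu Ad; have Uunit := unitarymx_unit Uu.
have An : A \is normalmx.
  by apply/orthomx_spectral_subproof; exists (U, map_mx (real_complex R) d).
have /orthomx_spectralP := An; rewrite /herm_fun.
have := mulmxV (spectral_unit A); have := mulVmx (spectral_unit A).
have := mulmxV Uunit; have := mulVmx Uunit; move: Ad {Uu Uunit An}.
move: (spectralmx A) (spectral_diag A) (invmx (spectralmx A)) (invmx U).
move=> P e Q V Ad VU UV QP PQ As.
have PA : P *m A = diag_mx e *m P by rewrite As !mulmxA PQ mul1mx.
have AV : A *m V = V *m diag_mx (map_mx (real_complex R) d).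
  by rewrite Ad -!mulmxA UV mulmx1.
have W : diag_mx e *m (P *m V) =
         P *m V *m diag_mx (map_mx (real_complex R) d).
  by rewrite mulmxA -PA -!mulmxA AV.
have /(congr1 (fun X => Q *m X *m U)) := diag_mx_intertwine f W.
by rewrite -!mulmxA VU mulmx1 !mulmxA QP mul1mx.
Qed.

End HermitianMatrices.

Section Calculus.
Variables (R : realType) (m : nat).
Implicit Types (f : 'cV[R]_m -> R) (u : 'cV[R]_m).

Definition partial (i : 'I_m) f : 'cV[R]_m -> R :=
  fun u => 'D_(delta_mx i 0) f u.

Definition gradient f u : 'cV[R]_m := \col_i partial i f u.

(* Infinitely differentiable on the open set Theta: f and all its iterated
   partial derivatives are differentiable at every point of Theta. *)
Definition smooth_on (Theta : set 'cV[R]_m) f : Prop :=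
  forall (s : seq 'I_m) u, Theta u -> differentiable (foldr partial f s) u.

Variable n : nat.
Implicit Types A : 'cV[R]_m -> 'M[R[i]]_n.

Definition mx_smooth_on (Theta : set 'cV[R]_m) A : Prop :=
  forall a b, smooth_on Theta (fun u => complex.Re (A u a b)) /\
              smooth_on Theta (fun u => complex.Im (A u a b)).

Definition mx_partial (i : 'I_m) A u : 'M[R[i]]_n :=
  \matrix_(a, b) (partial i (fun v => complex.Re (A v a b)) u
                  +i* partial i (fun v => complex.Im (A v a b)) u).

(* The image of Theta under A is a submanifold of P(n) with global
   coordinates u, i.e. A is an injective immersion of Theta into P(n). *)
Record coordinate_submanifold (Theta : set 'cV[R]_m) A : Prop := {
  coord_open : open Theta;
  coord_posdef : forall u, Theta u -> posdefmx (A u);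
  coord_smooth : mx_smooth_on Theta A;
  coord_inj : forall u v, Theta u -> Theta v -> A u = A v -> u = v;
  coord_immersion : forall u, Theta u -> forall c : 'I_m -> R,
    \sum_i (c i)%:C *: mx_partial i A u = 0 -> forall i, c i = 0 }.

Definition metric_matrix A u : 'M[R]_m :=
  \matrix_(i, j) riem_metric (A u) (mx_partial i A u) (mx_partial j A u).

Definition riemannian_gradient (G : 'cV[R]_m -> 'M[R]_m)
    (L : 'cV[R]_m -> R) (theta : 'cV[R]_m) : 'cV[R]_m :=
  invmx (G theta) *m gradient L theta.

Definition natural_gradient_descent (G : 'cV[R]_m -> 'M[R]_m)
    (L : 'cV[R]_m -> R) (eta : nat -> R) (theta : nat -> 'cV[R]_m) : Prop :=
  forall k, theta k.+1 = theta k - eta k *: riemannian_gradient G L (theta k).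

Definition sq_dist_cost A (B : 'M[R[i]]_n) u : R := geodesic_dist (A u) B ^+ 2.

End Calculus.

(* Main.v *)
(* Write C = B^{-1/2} A B^{-1/2}.  The matrix A^{-1/2} B A^{-1/2} is similar to
   C^{-1}, so that J = tr (ln C)^2, and the gradient formula is the rule
   d tr f(C) = tr (f'(C) dC) for f = ln^2.  That rule is obtained without
   perturbation theory.  If X and Y are Hermitian with eigenvalues x_i and y_j,
   and w_ij is the squared modulus of the inner product of the corresponding
   eigenvectors, then
     tr f(Y) - tr f(X) - tr (f'(X) (Y - X))
       = sum_ij w_ij (f(y_j) - f(x_i) - f'(x_i) (y_j - x_i)),
     |Y - X|_F^2 = sum_ij w_ij (y_j - x_i)^2,
   so a quadratic bound on the scalar remainder of ln^2 gives the same bound for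
   matrices; the second identity also keeps the spectrum of Y away from 0 when Y
   is close to X.  The metric matrix is the Gram matrix of the linearly
   independent tangent vectors, hence invertible. *)
Require Import Defs.
From mathcomp Require Import all_boot all_order all_algebra.
From mathcomp Require Import complex.
From mathcomp Require Import all_classical all_reals all_analysis.
From mathcomp Require Import ring lra.
Import Order.TTheory GRing.Theory Num.Theory.
Import numFieldNormedType.Exports.
Local Open Scope classical_set_scope.
Local Open Scope ring_scope.
Local Open Scope complex_scope.
Local Open Scope sesquilinear_scope.

Set Implicit Arguments.
Unset Strict Implicit.
Unset Printing Implicit Defensive.

(** * Algebra of conjugated diagonal matrices, traces and inverses *)

Lemma eq_mul_diag_mx (R : pzSemiRingType) (m n p : nat) (U : 'M[R]_(m, n))
  (d e : 'rV[R]_n) (V : 'M[R]_(n, p)) :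
  d 0 =1 e 0 -> U *m diag_mx d *m V = U *m diag_mx e *m V.
Proof.
move=> de; suff -> : d = e by [].
by apply/rowP => i; rewrite de.
Qed.

Lemma mul_conj_diag_mx (R : pzRingType) (n : nat) (P Q : 'M[R]_n)
  (d e : 'rV[R]_n) : P *m Q = 1%:M ->
  (Q *m diag_mx d *m P) *m (Q *m diag_mx e *m P) =
  Q *m diag_mx (\row_i (d 0 i * e 0 i)) *m P.
Proof.
move=> PQ; rewrite -mulmx_diag !mulmxA.
by rewrite -[_ *m P *m Q]mulmxA PQ mulmx1.
Qed.

Lemma conj_diag_mxE (R : pzRingType) (n : nat) (P Q : 'M[R]_n)
  (d : 'rV[R]_n) (i : 'I_n) : P *m Q = 1%:M ->
  (delta_mx (0 : 'I_1) i *m P *m (Q *m diag_mx d *m P) *m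
   (Q *m delta_mx i (0 : 'I_1))) 0 0 = d 0 i.
Proof.
move=> PQ; rewrite !mulmxA -[_ *m P *m Q]mulmxA PQ mulmx1.
by rewrite -[_ *m P *m Q]mulmxA PQ mulmx1 -rowE -colE !mxE eqxx mulr1n.
Qed.

Lemma mxtrace_conj_diag_mx (R : comPzRingType) (n : nat)
  (P Q P' Q' : 'M[R]_n) (d e : 'rV[R]_n) :
  \tr ((Q *m diag_mx d *m P) *m (Q' *m diag_mx e *m P')) =
  \sum_i \sum_j d 0 i * (P *m Q') i j * e 0 j * (P' *m Q) j i.
Proof.
rewrite -!mulmxA mxtrace_mulC -!mulmxA (mulmxA P); apply: eq_bigr => i _.
rewrite mul_diag_mx mxE [X in _ * X]mxE mulr_sumr; apply: eq_bigr => j _.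
by rewrite mul_diag_mx [(\matrix_(_, _) _) _ _]mxE !mulrA.
Qed.

Lemma mxtrace_mul_sqr (R : comPzRingType) (n : nat) (T X : 'M[R]_n) :
  \tr (T *m T *m X *m (T *m T) *m X) = \tr ((T *m X *m T) *m (T *m X *m T)).
Proof. by rewrite -!mulmxA mxtrace_mulC !mulmxA. Qed.

Lemma mxtrace_mul_conj (R : comPzRingType) (n : nat) (L D X : 'M[R]_n) :
  \tr (L *m D *m L *m X) = \tr (D *m (L *m X *m L)).
Proof. by rewrite -!mulmxA mxtrace_mulC -!mulmxA. Qed.

Lemma invmx_sqr (R : comUnitRingType) (n : nat) (S : 'M[R]_n) :
  S \in unitmx -> invmx (S *m S) = invmx S *m invmx S.
Proof.
move=> Su; have SSu : S *m S \in unitmx by rewrite unitmx_mul Su.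
by apply: (can_inj (mulKmx SSu)); rewrite mulmxV // -mulmxA mulKVmx ?mulmxV.
Qed.

Lemma invmx_congr (R : comUnitRingType) (n : nat) (S X : 'M[R]_n) :
  S \in unitmx -> X \in unitmx ->
  invmx (invmx S *m X *m invmx S) = S *m invmx X *m S.
Proof.
move=> Su Xu; have Yu : invmx S *m X *m invmx S \in unitmx.
  by rewrite !unitmx_mul unitmx_inv Su Xu.
apply: (can_inj (mulKmx Yu)); rewrite mulmxV // -!mulmxA mulKmx //.
by rewrite mulKVmx ?mulVmx.
Qed.

(** * Scalar estimates for the logarithm and its square *)

Lemma ln_sub_bounds (R : realType) (x y : R) : 0 < x -> 0 < y ->
  (y - x) / y <= ln y - ln x <= (y - x) / x.
Proof.
(* This is [ln (1 + t) <= t] at [t = (b - a) / a]. The lower bound of the lemma follows by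
   exchanging [x] and [y]. *)
have ub (a b : R) : 0 < a -> 0 < b -> ln b - ln a <= (b - a) / a.
  move=> a0 b0; rewrite -ln_div ?posrE //.
  have -> : b / a = 1 + (b - a) / a by field; rewrite gt_eqF.
  apply: le_ln1Dx; rewrite mulrBl divff ?gt_eqF // ltrBrDr addNr.
  exact: divr_gt0.
move=> x0 y0; rewrite ub // andbT.
by rewrite -opprB mulNr lerNl opprB ub.
Qed.

(** With [t = ln y - ln x], the first-order remainder of [ln ^ 2] is
    [t ^ 2 + 2 ln x (t - (y - x) / x)]. Both [t ^ 2] and the distance from [t] to [(y - x) / x] are
    at most [e = (y - x) ^ 2 / d ^ 2], which gives the factor [1 + 2 |ln x|]. *)
Lemma ln_sqr_remainder (R : realType) (d x y : R) :
  0 < d -> d <= x -> d <= y ->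
  `|ln y ^+ 2 - ln x ^+ 2 - 2 * ln x / x * (y - x)| <=
  (1 + 2 * `|ln x|) / d ^+ 2 * (y - x) ^+ 2.
Proof.
move=> d0 dx dy; have x0 := lt_le_trans d0 dx; have y0 := lt_le_trans d0 dy.
have /andP[lb ub] := ln_sub_bounds x0 y0.
set t := ln y - ln x in lb ub *; set e := (y - x) ^+ 2 / d ^+ 2.
have e0 : 0 <= e by rewrite divr_ge0 // sqr_ge0.
(* This is the gap between the two bounds on [t], so it also bounds how far [t] lies below its
   tangent value [(y - x) / x]. *)
have diffE : (y - x) / x - (y - x) / y = (y - x) ^+ 2 / (x * y).
  by field; rewrite !gt_eqF.
have diff_le : (y - x) / x - (y - x) / y <= e.
  rewrite diffE ler_wpM2l ?sqr_ge0 // lef_pV2 ?posrE ?mulr_gt0 ?exprn_gt0 //.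
  by rewrite expr2 ler_pM // ltW.
have t2 : t ^+ 2 <= e.
  have dd (z : R) : d <= z -> `|(y - x) / z| <= `|y - x| / d.
    move=> dz; have z0 := lt_le_trans d0 dz.
    by rewrite normrM normfV (gtr0_norm z0) ler_wpM2l // lef_pV2 ?posrE.
  have : `|t| <= `|y - x| / d.
    rewrite ler_norml; apply/andP; split.
      by apply: le_trans lb; have := dd _ dy; rewrite ler_norml => /andP[].
    by apply: (le_trans ub); have := dd _ dx; rewrite ler_norml => /andP[].
  rewrite -ler_sqr ?nnegrE ?divr_ge0 ?(ltW d0) // expr_div_n.
  by rewrite !real_normK ?num_real.
have -> : ln y ^+ 2 - ln x ^+ 2 - 2 * ln x / x * (y - x) =
    t ^+ 2 + 2 * ln x * (t - (y - x) / x) by rewrite /t; ring.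
have -> : (1 + 2 * `|ln x|) / d ^+ 2 * (y - x) ^+ 2 = e + 2 * `|ln x| * e.
  by rewrite /e; ring.
apply: (le_trans (ler_normD _ _)); apply: lerD.
  by rewrite ger0_norm ?sqr_ge0.
rewrite normrM normrM ger0_norm // ler_wpM2l // ?mulr_ge0 //.
rewrite ler_norml; apply/andP; split; last by rewrite (le_trans _ e0) // subr_le0.
by move: lb diff_le; move: (_ / y) (_ / x) => p q; lra.
Qed.

(** * Functional calculus of Hermitian matrices *)

Section HermitianCalculus.
Variables (R : realType) (n : nat).
Implicit Types (X Y Z : 'M[R[i]]_n) (f g : R -> R).

Definition eigen X (i : 'I_n) : R := complex.Re (spectral_diag X 0 i).

Lemma hermsymmxP X : X \is hermsymmx <-> X^t* = X.
Proof.
split=> [/is_hermitianmxP|XE]; first by rewrite expr0 scale1r => <-.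
by apply/is_hermitianmxP; rewrite expr0 scale1r XE.
Qed.

Lemma adjmxM (m p q : nat) (U : 'M[R[i]]_(m, p)) (V : 'M[R[i]]_(p, q)) :
  (U *m V)^t* = V^t* *m U^t*.
Proof. by rewrite trmx_mul map_mxM. Qed.

Lemma adjmxV X : (invmx X)^t* = invmx (X^t*).
Proof. by rewrite trmx_inv map_invmx. Qed.

Lemma adjmxB X Y : (X - Y)^t* = X^t* - Y^t*.
Proof. by apply/matrixP => a b; rewrite !mxE rmorphB. Qed.

Lemma conjC_complex_real (x : R) : Num.conj (x%:C : R[i]) = x%:C.
Proof. exact: conjc_real. Qed.

Lemma adj_diag_mx (d : 'I_n -> R) :
  (diag_mx (\row_i (d i)%:C) : 'M[R[i]]_n)^t* = diag_mx (\row_i (d i)%:C).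
Proof.
rewrite tr_diag_mx map_diag_mx; congr diag_mx.
by apply/rowP => i; rewrite !mxE; exact: conjC_complex_real.
Qed.

Lemma herm_funE f X :
  herm_fun f X = (spectralmx X)^t* *m
    diag_mx (\row_i (f (eigen X i))%:C) *m spectralmx X.
Proof.
rewrite -(invmx_unitary (spectral_unitarymx X)).
by apply: eq_mul_diag_mx => i; rewrite !mxE.
Qed.

Lemma spectral_adjK X : spectralmx X *m (spectralmx X)^t* = 1%:M.
Proof. exact/unitarymxP/spectral_unitarymx. Qed.

Lemma spectral_adjVK X : (spectralmx X)^t* *m spectralmx X = 1%:M.
Proof. exact/mulmx1C/spectral_adjK. Qed.

(** This is the spectral theorem: the eigenvalues of a Hermitian matrix are real, so passing to
    their real parts loses nothing. *)
Lemma herm_fun_id X : X^t* = X -> herm_fun id X = X.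
Proof.
move=> XX; have Xh : X \is hermsymmx by apply/hermsymmxP.
rewrite [RHS](orthomx_spectralP (hermitian_normalmx Xh)).
apply: eq_mul_diag_mx => i; rewrite !mxE.
by apply: RRe_real; apply/mxOverP/hermitian_spectral_diag_real.
Qed.

Lemma herm_fun_cst1 X : herm_fun (fun=> 1) X = 1%:M.
Proof.
rewrite -[RHS](mulVmx (spectral_unit X)) -[invmx _]mulmx1.
rewrite -diag_const_mx.
by apply: eq_mul_diag_mx => i; rewrite !mxE.
Qed.

Lemma herm_funM f g X :
  herm_fun f X *m herm_fun g X = herm_fun (fun x => f x * g x) X.
Proof.
rewrite [LHS](mul_conj_diag_mx _ _ (mulmxV (spectral_unit X))).
by apply: eq_mul_diag_mx => i; rewrite !mxE rmorphM.
Qed.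

Lemma herm_fun_adj f X : (herm_fun f X)^t* = herm_fun f X.
Proof.
by rewrite herm_funE adjmxM adjmxM trmxCK adj_diag_mx mulmxA.
Qed.

Lemma eq_herm_fun f g X :
  (forall i, f (eigen X i) = g (eigen X i)) -> herm_fun f X = herm_fun g X.
Proof.
by move=> fg; apply: eq_mul_diag_mx => i; rewrite !mxE -!/(eigen X i) fg.
Qed.

Lemma herm_funZ (a : R) f X :
  herm_fun (fun x => a * f x) X = a%:C *: herm_fun f X.
Proof.
rewrite /herm_fun scalemxAl scalemxAr -linearZ.
by apply: eq_mul_diag_mx => i; rewrite !mxE rmorphM.
Qed.

Lemma herm_fun_inv f X : (forall i, f (eigen X i) != 0) ->
  herm_fun f X \in unitmx /\
  invmx (herm_fun f X) = herm_fun (fun x => (f x)^-1) X.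
Proof.
move=> f0; have fV : herm_fun f X *m herm_fun (fun x => (f x)^-1) X = 1%:M.
  rewrite herm_funM -(herm_fun_cst1 X); apply: eq_herm_fun => i.
  by rewrite divff.
have [fu _] := mulmx1_unit fV; split => //.
by rewrite -[RHS]mul1mx -(mulVmx fu) -mulmxA fV mulmx1.
Qed.

Lemma posdefmx_adj X : posdefmx X -> X^t* = X.
Proof. by case=> /hermsymmxP. Qed.

(** The quadratic form evaluated at the [i]-th unit eigenvector is the [i]-th eigenvalue. *)
Lemma posdefmx_eigen_gt0 X : posdefmx X -> forall i, 0 < eigen X i.
Proof.
move=> Xp i; have XX := posdefmx_adj Xp; case: Xp => _ Xp.
pose e : 'cV[R[i]]_n := delta_mx i 0.
have ee : e^t* = delta_mx 0 i.
  by apply/matrixP => a b; rewrite !mxE ord1 eqxx andbT;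
     case: eqP => _; rewrite ?conjC1 ?conjC0.
have /Xp : (spectralmx X)^t* *m e != 0.
  apply/eqP => /(congr1 (mulmx (spectralmx X))).
  rewrite mulmxA spectral_adjK mul1mx mulmx0 => /matrixP/(_ i 0).
  by rewrite !mxE !eqxx => /eqP; rewrite oner_eq0.
rewrite adjmxM trmxCK ee -{2}(herm_fun_id XX) herm_funE.
by rewrite (conj_diag_mxE _ _ (spectral_adjK X)) !mxE ltcR.
Qed.

(** * Overlaps of two eigenbases, and traces as double sums weighted by them *)

Lemma realC_sum (I : finType) (F : I -> R) :
  (\sum_i F i)%:C = \sum_i (F i)%:C :> R[i].
Proof. exact: rmorph_sum. Qed.

Lemma realCM (x y : R) : (x * y)%:C = x%:C * y%:C :> R[i].
Proof. exact: rmorphM. Qed.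

Lemma realCB (x y : R) : (x - y)%:C = x%:C - y%:C :> R[i].
Proof. exact: rmorphB. Qed.

Definition overlap X Y (i j : 'I_n) : R :=
  let z := (spectralmx X *m (spectralmx Y)^t*) i j in
  complex.Re z ^+ 2 + complex.Im z ^+ 2.

Lemma overlap_ge0 X Y i j : 0 <= overlap X Y i j.
Proof. by rewrite addr_ge0// sqr_ge0. Qed.

Lemma overlapE X Y i j : (overlap X Y i j)%:C =
  (spectralmx X *m (spectralmx Y)^t*) i j *
  (spectralmx Y *m (spectralmx X)^t*) j i.
Proof.
have -> : spectralmx Y *m (spectralmx X)^t* =
    (spectralmx X *m (spectralmx Y)^t*)^t* by rewrite adjmxM trmxCK.
by rewrite [X in _ * X]mxE [X in _ * Num.conj X]mxE -normCK -add_Re2_Im2.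
Qed.

(** The overlaps are the squared moduli of the entries of a unitary matrix, whose columns have norm
    1. *)
Lemma overlap_sum_col X Y j : \sum_i overlap X Y i j = 1.
Proof.
apply: complexI; rewrite realC_sum.
under eq_bigr => i _ do rewrite overlapE mulrC.
have : spectralmx Y *m (spectralmx X)^t* *m (spectralmx X *m (spectralmx Y)^t*)
    = 1%:M.
  rewrite mulmxA -[_ *m _ *m spectralmx X]mulmxA spectral_adjVK mulmx1.
  exact: spectral_adjK.
by move/matrixP/(_ j j); rewrite !mxE eqxx.
Qed.

Lemma mxtrace_herm_funM f g X Y :
  \tr (herm_fun f X *m herm_fun g Y) =
  (\sum_i \sum_j overlap X Y i j * (f (eigen X i) * g (eigen Y j)))%:C.
Proof.
rewrite !herm_funE mxtrace_conj_diag_mx realC_sum; apply: eq_bigr => i _.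
rewrite realC_sum; apply: eq_bigr => j _; rewrite !realCM overlapE.
by rewrite [in LHS]mxE [X in _ * X * _]mxE; ring.
Qed.

(** Inserting the identity as the constant function 1 of [Y] puts a trace that involves [X] alone on
    the same weights as the mixed traces, so that they can be combined term by term. *)
Lemma mxtrace_herm_funl f X Y : \tr (herm_fun f X) =
  (\sum_i \sum_j overlap X Y i j * f (eigen X i))%:C.
Proof.
rewrite -[herm_fun f X]mulmx1 -(herm_fun_cst1 Y) mxtrace_herm_funM.
by congr (_%:C); apply: eq_bigr => i _; apply: eq_bigr => j _; rewrite mulr1.
Qed.

Lemma mxtrace_herm_funr f X Y : \tr (herm_fun f Y) =
  (\sum_i \sum_j overlap X Y i j * f (eigen Y j))%:C.
Proof.
rewrite -[herm_fun f Y]mul1mx -(herm_fun_cst1 X) mxtrace_herm_funM.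
by congr (_%:C); apply: eq_bigr => i _; apply: eq_bigr => j _; rewrite mul1r.
Qed.

Lemma herm_fun_mul f X : X^t* = X ->
  herm_fun f X *m X = herm_fun (fun x => f x * x) X.
Proof. by move=> XX; rewrite -{2}(herm_fun_id XX) herm_funM. Qed.

Lemma herm_fun_sqr X : X^t* = X -> X *m X = herm_fun (fun x => x * x) X.
Proof. by move=> XX; rewrite -{1 2}(herm_fun_id XX) herm_funM. Qed.

Lemma mxtrace_herm_fun_remainder f h X Y : X^t* = X -> Y^t* = Y ->
  \tr (herm_fun f Y) - \tr (herm_fun f X) - \tr (herm_fun h X *m (Y - X)) =
  (\sum_i \sum_j overlap X Y i j *
     (f (eigen Y j) - f (eigen X i) -
      h (eigen X i) * (eigen Y j - eigen X i)))%:C.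
Proof.
move=> XX YY; rewrite mulmxBr raddfB /= (herm_fun_mul _ XX).
have -> : \tr (herm_fun h X *m Y) =
    (\sum_i \sum_j overlap X Y i j * (h (eigen X i) * eigen Y j))%:C.
  by rewrite -(mxtrace_herm_funM h id) (herm_fun_id YY).
rewrite [T in T - _ - _](mxtrace_herm_funr f X Y).
rewrite [T in _ - T - _](mxtrace_herm_funl f X Y).
rewrite [T in _ - (_ - T)](mxtrace_herm_funl _ X Y).
rewrite -!realCB -!sumrB; congr (_%:C); apply: eq_bigr => i _.
by rewrite -!sumrB; apply: eq_bigr => j _ /=; ring.
Qed.

Lemma mxtrace_sqrB X Y : X^t* = X -> Y^t* = Y ->
  \tr ((Y - X) *m (Y - X)) =
  (\sum_i \sum_j overlap X Y i j * (eigen Y j - eigen X i) ^+ 2)%:C.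
Proof.
move=> XX YY; rewrite mulmxBl !mulmxBr 2!raddfB /= raddfB /=.
rewrite [\tr (Y *m X)]mxtrace_mulC (herm_fun_sqr XX) (herm_fun_sqr YY).
have -> : \tr (X *m Y) =
    (\sum_i \sum_j overlap X Y i j * (eigen X i * eigen Y j))%:C.
  by rewrite -(mxtrace_herm_funM id id) (herm_fun_id XX) (herm_fun_id YY).
rewrite (mxtrace_herm_funr _ X Y) !(mxtrace_herm_funl _ X Y).
rewrite -!realCB -!sumrB; congr (_%:C); apply: eq_bigr => i _.
by rewrite -!sumrB; apply: eq_bigr => j _ /=; ring.
Qed.

(** * Positive definite matrices, square roots and the geodesic distance *)

Lemma posdefmx_unit X : posdefmx X ->
  X \in unitmx /\ invmx X = herm_fun (fun x => x^-1) X.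
Proof.
move=> Xp; have X0 i : eigen X i != 0 by rewrite gt_eqF ?posdefmx_eigen_gt0.
by have := herm_fun_inv (f := id) X0; rewrite (herm_fun_id (posdefmx_adj Xp)).
Qed.

Lemma herm_sqrt_posdef X : posdefmx X ->
  herm_sqrt X \in unitmx /\ herm_sqrt X *m herm_sqrt X = X.
Proof.
move=> Xp; have Xgt0 := posdefmx_eigen_gt0 Xp; split.
  have [i|] := @herm_fun_inv Num.sqrt X; last by [].
  by rewrite gt_eqF // sqrtr_gt0.
rewrite herm_funM -[RHS](herm_fun_id (posdefmx_adj Xp)).
by apply: eq_herm_fun => i; rewrite -expr2 sqr_sqrtr // ltW.
Qed.

Lemma posdefmx_congr X (L : 'M[R[i]]_n) : L \in unitmx -> L^t* = L ->
  posdefmx X -> posdefmx (L *m X *m L).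
Proof.
move=> Lu LL Xp; split.
  by apply/hermsymmxP; rewrite !adjmxM LL (posdefmx_adj Xp) mulmxA.
move=> x x0; have -> : x^t* *m (L *m X *m L) *m x =
    (L *m x)^t* *m X *m (L *m x) by rewrite adjmxM LL !mulmxA.
case: Xp => _; apply; apply: contraNneq x0 => /(congr1 (mulmx (invmx L))).
by rewrite mulmxA mulVmx // mul1mx mulmx0 => ->.
Qed.

Lemma mxtrace_mul_adj X : \tr (X *m X^t*) =
  (\sum_i \sum_j (complex.Re (X i j) ^+ 2 + complex.Im (X i j) ^+ 2))%:C.
Proof.
rewrite realC_sum; apply: eq_bigr => i _; rewrite mxE realC_sum.
by apply: eq_bigr => j _; rewrite add_Re2_Im2 normCK !mxE.
Qed.

Lemma frob_norm_sqr X : (frob_norm X ^+ 2)%:C = \tr (X *m X^t*).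
Proof.
have nE z : Normc.normc z ^+ 2 = complex.Re z ^+ 2 + complex.Im z ^+ 2 :> R.
  by case: z => a b; rewrite sqr_sqrtr // addr_ge0 // sqr_ge0.
rewrite mxtrace_mul_adj sqr_sqrtr; last first.
  by apply: sumr_ge0 => i _; apply: sumr_ge0 => j _; rewrite sqr_ge0.
by congr (_%:C); apply: eq_bigr => i _; apply: eq_bigr => j _; rewrite nE.
Qed.

(** The intertwiner [N] need not be unitary. In the two eigenbases it has a nonzero entry at
    [(i, j)] only if [g (x_i) = y_j], so it still intertwines after [f] is applied to both sides,
    and the trace is invariant under similarity. *)
Lemma mxtrace_herm_fun_similar f g X Y (N : 'M[R[i]]_n) : Y^t* = Y ->
  N \in unitmx -> herm_fun g X *m N = N *m Y ->
  \tr (herm_fun (f \o g) X) = \tr (herm_fun f Y).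
Proof.
move=> YY Nu gN.
suff fN : herm_fun (f \o g) X *m N = N *m herm_fun f Y.
  rewrite -[herm_fun f Y](mulKmx Nu) -fN [RHS]mxtrace_mulC -mulmxA mulmxV //.
  by rewrite mulmx1.
have := gN; rewrite -{1}(herm_fun_id YY) !herm_funE.
have := spectral_adjVK Y; have := spectral_adjK Y.
have := spectral_adjVK X; have := spectral_adjK X.
set P := spectralmx X; set P' := P^t*; set Q := spectralmx Y; set Q' := Q^t*.
set dX := (\row_i (g _)%:C); set dY := (\row_i (id _)%:C).
move: P P' Q Q' => P P' Q Q' PP' P'P QQ' Q'Q gN'.
pose d : 'rV[R]_n := \row_i eigen Y i.
have dYE : dY = map_mx (real_complex R) d by apply/rowP => i; rewrite !mxE.
(* In the eigenbases the hypothesis on [N] becomes an intertwining of diagonal matrices, to which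
   [diag_mx_intertwine] applies. *)
have W : diag_mx dX *m (P *m N *m Q') =
    P *m N *m Q' *m diag_mx (map_mx (real_complex R) d).
  rewrite -dYE.
  have := congr1 (fun Z => P *m Z *m Q') gN'.
  rewrite !mulmxA PP' mul1mx => ->.
  by rewrite -(mulmxA _ Q Q') QQ' mulmx1.
have := congr1 (fun Z => P' *m Z *m Q) (diag_mx_intertwine f W).
rewrite !mulmxA P'P mul1mx -[_ *m Q' *m Q]mulmxA Q'Q mulmx1 => fW.
transitivity (P' *m diag_mx (map_mx (fun z => (f (complex.Re z))%:C) dX)
    *m P *m N).
  by congr (_ *m N); apply: eq_mul_diag_mx => i; rewrite !mxE.
rewrite fW.
by apply: eq_mul_diag_mx => i; rewrite !mxE.
Qed.

Lemma geodesic_dist_sqr X Y : posdefmx X -> posdefmx Y ->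
  (geodesic_dist X Y ^+ 2)%:C =
  \tr (herm_fun (fun x => ln x ^+ 2)
        (invmx (herm_sqrt Y) *m X *m invmx (herm_sqrt Y))).
Proof.
move=> Xp Yp; rewrite frob_norm_sqr herm_fun_adj herm_funM.
have [Xu sX] := herm_sqrt_posdef Xp; have [Yu sY] := herm_sqrt_posdef Yp.
have XX := herm_fun_adj Num.sqrt X; have YY := herm_fun_adj Num.sqrt Y.
rewrite -!/(herm_sqrt _) in XX YY; move: Xu sX XX Yu sY YY.
move: (herm_sqrt X) (herm_sqrt Y) => S T Su SS Sh Tu TT Th.
have SVh : (invmx S)^t* = invmx S by rewrite adjmxV Sh.
have TVh : (invmx T)^t* = invmx T by rewrite adjmxV Th.
have Cp : posdefmx (invmx T *m X *m invmx T).
  by apply: posdefmx_congr; rewrite ?unitmx_inv.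
have [_ CV] := posdefmx_unit Cp; have [Xu _] := posdefmx_unit Xp.
(* Since [ln ^ 2] is invariant under inversion, [C = T^-1 X T^-1] may be replaced by
   [C^-1 = T X^-1 T]. *)
have lnV2 : herm_fun (fun x => ln x ^+ 2) (invmx T *m X *m invmx T) =
    herm_fun ((fun x => ln x ^+ 2) \o (fun x => x^-1))
      (invmx T *m X *m invmx T).
  move: Cp {CV}; move: (invmx T *m _ *m _) => C Cp.
  apply: eq_herm_fun => i /=.
  by rewrite lnV ?posrE ?posdefmx_eigen_gt0 // sqrrN.
rewrite lnV2; symmetry.
(* With [X = S S] and [Y = T T], both [C^-1 (T S^-1)] and [(T S^-1) (S^-1 Y S^-1)] equal
   [T X^-1 Y S^-1]. *)
apply: (@mxtrace_herm_fun_similar _ _ _ _ (T *m invmx S)).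
- by rewrite !adjmxM SVh (posdefmx_adj Yp) mulmxA.
- by rewrite unitmx_mul Tu unitmx_inv.
by rewrite -CV (invmx_congr Tu Xu) -SS (invmx_sqr Su) -TT !mulmxA.
Qed.

(** * The quadratic remainder estimate for matrices *)

Lemma eigen_lower_bound X : posdefmx X ->
  exists2 d : R, 0 < d & forall i, 2 * d <= eigen X i.
Proof.
move=> Xp; have X0 := posdefmx_eigen_gt0 Xp.
(* The inverse of this sum replaces the minimum of the eigenvalues; the summand 1 keeps it positive
   when [n = 0]. The factor 2 in the bound leaves room for the eigenvalues of a nearby matrix to
   stay above [d]. *)
pose s := 1 + \sum_i (eigen X i)^-1.
have sge i : (eigen X i)^-1 <= s.
  rewrite /s (bigD1 i) //= addrCA lerDl addr_ge0 // sumr_ge0 // => j _.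
  by rewrite invr_ge0 ltW.
have s0 : 0 < s.
  by rewrite ltr_wpDr // sumr_ge0 // => j _; rewrite invr_ge0 ltW.
exists (s^-1 / 2); first by rewrite divr_gt0 ?invr_gt0.
move=> i; rewrite mulrCA divff ?pnatr_eq0 // mulr1.
by rewrite -[leRHS]invrK lef_pV2 ?posrE ?invr_gt0.
Qed.

Lemma eigen_near X Y (d : R) : X^t* = X -> Y^t* = Y -> 0 < d ->
  (forall i, 2 * d <= eigen X i) ->
  complex.Re (\tr ((Y - X) *m (Y - X))) < d ^+ 2 ->
  forall j, d <= eigen Y j.
Proof.
move=> XX YY d0 Xd; rewrite (mxtrace_sqrB XX YY) /= => small j.
rewrite leNgt; apply/negP => Yj; move: small; apply/negP; rewrite -leNgt.
(* If y_j < d, then |x_i - y_j| >= d for every i, and the weights in column j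
   sum to 1. *)
rewrite exchange_big (bigD1 j) //=.
rewrite -[leLHS]addr0; apply: lerD; last first.
  apply: sumr_ge0 => k _; apply: sumr_ge0 => i _.
  by rewrite mulr_ge0 ?overlap_ge0 ?sqr_ge0.
rewrite -[leLHS]mul1r -(overlap_sum_col X Y j) mulr_suml.
apply: ler_sum => i _; rewrite ler_wpM2l ?overlap_ge0 //.
rewrite -[leRHS]sqrrN opprB ler_sqr ?nnegrE ?ltW //.
  by have := Xd i; lra.
by have := Xd i; lra.
Qed.

Lemma mxtrace_ln_sqr_remainder X : posdefmx X ->
  exists2 d : R, 0 < d & exists K : R, forall Y, Y^t* = Y ->
    complex.Re (\tr ((Y - X) *m (Y - X))) < d ->
    `|complex.Re (\tr (herm_fun (fun x => ln x ^+ 2) Y)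
        - \tr (herm_fun (fun x => ln x ^+ 2) X)
        - \tr (herm_fun (fun x => 2 * ln x / x) X *m (Y - X)))| <=
    K * complex.Re (\tr ((Y - X) *m (Y - X))).
Proof.
move=> Xp; have XX := posdefmx_adj Xp; have [d d0 Xd] := eigen_lower_bound Xp.
exists (d ^+ 2); first exact: exprn_gt0.
(* This is the scalar constant of [ln_sqr_remainder] at the [i]-th eigenvalue of [X]. The sum of all
   of them dominates each one and does not depend on [Y]. *)
pose k i := (1 + 2 * `|ln (eigen X i)|) / d ^+ 2.
have k0 i : 0 <= k i by rewrite divr_ge0 ?sqr_ge0 // addr_ge0 // mulr_ge0.
exists (\sum_i k i) => Y YY /(eigen_near XX YY d0 Xd) Yd.
rewrite (mxtrace_herm_fun_remainder _ _ XX YY) (mxtrace_sqrB XX YY) /=.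
rewrite mulr_sumr (le_trans (ler_norm_sum _ _ _)) //; apply: ler_sum => i _.
rewrite mulr_sumr (le_trans (ler_norm_sum _ _ _)) //; apply: ler_sum => j _.
rewrite normrM (ger0_norm (overlap_ge0 _ _ _ _)) mulrCA.
rewrite ler_wpM2l ?overlap_ge0 //.
apply: (le_trans (ln_sqr_remainder d0 _ (Yd j))).
  by rewrite (le_trans _ (Xd i)) // ler_peMl ?ltW // ltr1n.
rewrite ler_wpM2r ?sqr_ge0 // (bigD1 i) //= lerDl.
by apply: sumr_ge0.
Qed.

(** * Reality and definiteness of the Riemannian metric *)

Lemma mxtrace_herm_real X Y : X^t* = X -> Y^t* = Y ->
  \tr (X *m Y) = (complex.Re (\tr (X *m Y)))%:C.
Proof.
move=> XX YY; apply/esym/RRe_real/CrealP.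
by rewrite -trace_map_mx -mxtrace_tr map_trmx adjmxM XX YY mxtrace_mulC.
Qed.

Lemma riem_metricE A X Y : A^t* = A -> X^t* = X -> Y^t* = Y ->
  (riem_metric A X Y)%:C = \tr (invmx A *m X *m invmx A *m Y).
Proof.
move=> AA XX YY; rewrite [RHS]mxtrace_herm_real //.
by rewrite !adjmxM adjmxV AA XX mulmxA.
Qed.

(** With [T = A^-1/2], the value of the metric at [X, X] is the squared Frobenius norm of [T X T],
    and [T] is invertible. *)
Lemma riem_metric_eq0 A X : posdefmx A -> X^t* = X ->
  riem_metric A X X = 0 -> X = 0.
Proof.
move=> Ap XX; have [Su SS] := herm_sqrt_posdef Ap; rewrite /riem_metric.
have Sh : (herm_sqrt A)^t* = herm_sqrt A by exact: herm_fun_adj.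
move: (herm_sqrt A) Su SS Sh => S Su SS Sh; set T := invmx S.
have Th : T^t* = T by rewrite adjmxV Sh.
have TT : invmx A = T *m T by rewrite -SS invmx_sqr.
have Zh : (T *m X *m T)^t* = T *m X *m T by rewrite !adjmxM Th XX mulmxA.
have -> : \tr (invmx A *m X *m invmx A *m X) =
    \tr ((T *m X *m T) *m (T *m X *m T)^t*).
  by rewrite Zh TT mxtrace_mul_sqr.
rewrite mxtrace_mul_adj /= => /eqP; rewrite psumr_eq0; last first.
  by move=> i _; apply: sumr_ge0 => j _; rewrite addr_ge0 ?sqr_ge0.
move=> /allP Z0; have : T *m X *m T = 0.
  apply/matrixP => i j; have := Z0 i (mem_index_enum _) => /=.
  rewrite psumr_eq0; last by move=> k _; rewrite addr_ge0 ?sqr_ge0.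
  move=> /allP/(_ j (mem_index_enum _)) /=.
  rewrite paddr_eq0 ?sqr_ge0 // !sqrf_eq0 => /andP[/eqP re0 /eqP im0].
  by rewrite [RHS]mxE; apply/eqP; rewrite eq_complex re0 im0 !eqxx.
move=> /(congr1 (fun Z => S *m Z *m S)).
by rewrite mulmx0 mul0mx !mulmxA mulmxV // mul1mx -mulmxA mulVmx // mulmx1.
Qed.

End HermitianCalculus.

(** The difference quotients of [f] and [g] along [v] differ by at most [|K|] times that of [q],
    which tends to 0. This transfers a derivative from the linearization [g] to [f] by means of a
    quadratic error [q]. *)
Lemma is_derive_squeeze (R : realType) (V : normedModType R)
  (f g q : V -> R) (x v : V) (dg d K : R) :
  is_derive x v g dg -> is_derive x v q 0 -> q x = 0 -> 0 < d ->
  (\forall y \near x, q y < d ->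
     `|f y - f x - (g y - g x)| <= K * q y) ->
  is_derive x v f dg.
Proof.
move=> [gx gE] [qx qE] q0 d0 fgq.
pose quot (k : V -> R) := fun h : R => h^-1 *: ((k \o shift x) (h *: v) - k x).
have ql : quot q @ 0^' --> (0 : R) by rewrite -[X in _ --> X]qE; exact: qx.
have gl : quot g @ 0^' --> dg by rewrite -[X in _ --> X]gE; exact: gx.
have line : (fun h : R => h *: v + x) @ 0 --> x.
  rewrite -[X in _ --> X]add0r -[X in _ --> X + _](scale0r v).
  by apply: cvgD; [apply: cvgZr_tmp; exact: cvg_id|exact: cvg_cst].
have rl : (quot f \- quot g) @ 0^' --> (0 : R).
  apply/cvgr0Pnorm_lt => e e0.
  (* Adding 1 allows a division that remains valid when [K = 0]. *)
  have K0 : 0 < `|K| + 1 by rewrite ltr_wpDl.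
  near=> h.
  have h0 : h != 0 by near: h; exact: nbhs_dnbhs_neq.
  have qh : q (h *: v + x) = h * quot q h.
    by rewrite /quot /= q0 subr0 -[X in h * X]/(h^-1 * _) mulVKf.
  have quote : `|quot q h| < e / (`|K| + 1).
    by near: h; apply: (cvgr0_norm_lt _ ql); rewrite divr_gt0.
  have quot1 : `|quot q h| < 1 by near: h; apply: (cvgr0_norm_lt _ ql).
  have hd : `|h| < d.
    by near: h; apply: dnbhs0_lt.
  (* Only directional information on [q] is available, so its smallness is obtained along the line:
     [q] is [h] times a quotient below 1, with [|h| < d]. *)
  have qd : q (h *: v + x) < d.
    rewrite (le_lt_trans (ler_norm _)) // qh normrM -[ltRHS]mulr1.
    by rewrite ltr_pM.
  have : `|f (h *: v + x) - f x - (g (h *: v + x) - g x)| <= K * q (h *: v + x).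
    move: qd; near: h; apply: nbhs_dnbhs; exact: (line _ fgq).
  rewrite qh => fg; rewrite /= -scalerBr normrZ normfV.
  rewrite ltr_pdivrMl ?normr_gt0 // (le_lt_trans fg) //.
  rewrite (le_lt_trans (ler_norm _)) // (normrM K) (normrM h) mulrCA
    ltr_pM2l ?normr_gt0 //.
  rewrite ltr_pdivlMr // in quote; apply: le_lt_trans quote.
  by rewrite [leLHS]mulrC ler_wpM2l // lerDl.
have fl : quot f @ 0^' --> dg.
  have -> : quot f = (quot f \- quot g) \+ quot g.
    by apply/funext => h /=; rewrite subrK.
  by rewrite -[dg]add0r; apply: cvgD.
by split; [apply/cvg_ex; exists dg|exact: cvg_lim fl].
Unshelve. all: by end_near. Qed.

(** * Derivatives in the coordinates and the metric matrix *)

Section CoordinateDerivatives.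
Variables (R : realType) (n m : nat) (Theta : set 'cV[R]_m).
Variables (A : 'cV[R]_m -> 'M[R[i]]_n) (u : 'cV[R]_m).
Hypotheses (hA : coordinate_submanifold Theta A) (hu : Theta u).

Lemma adjmxZ_real (x : R) (X : 'M[R[i]]_n) :
  (x%:C *: X)^t* = x%:C *: X^t*.
Proof.
apply/matrixP => a b; rewrite !mxE rmorphM; congr (_ * _).
exact: conjC_complex_real.
Qed.

Lemma near_coord_domain : \forall v \near u, Theta v.
Proof. exact: open_nbhs_nbhs (conj (coord_open hA) hu). Qed.

(** Entries become traces against constant matrices, so one derivative rule, [is_derive_Re_mxtrace],
    serves both for the linearization and for the error term. *)
Lemma mxtrace_delta_mul (Z : 'M[R[i]]_n) (a b : 'I_n) :
  \tr (delta_mx b a *m Z) = Z a b.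
Proof.
rewrite /mxtrace (bigD1 b) //= big1 ?addr0 => [|i ib].
  rewrite mxE (bigD1 a) //= big1 ?addr0 => [|j ja].
    by rewrite mxE !eqxx mul1r.
  by rewrite mxE eqxx (negbTE ja) mul0r.
by rewrite mxE big1 // => j _; rewrite mxE (negbTE ib) mul0r.
Qed.

Lemma Re_mxtrace_mul (K Z : 'M[R[i]]_n) : complex.Re (\tr (K *m Z)) =
  \sum_a \sum_b (complex.Re (K a b) * complex.Re (Z b a) -
                 complex.Im (K a b) * complex.Im (Z b a)).
Proof.
have ReD : {morph @complex.Re R : x y / x + y} by case=> ? ? [].
rewrite (big_morph _ ReD (erefl _)); apply: eq_bigr => a _.
rewrite mxE (big_morph _ ReD (erefl _)); apply: eq_bigr => b _.
by case: (K a b) (Z b a) => ? ? [].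
Qed.

Lemma is_derive_Re_mxtrace i (K : 'M[R[i]]_n) :
  is_derive u (delta_mx i 0) (fun v => complex.Re (\tr (K *m A v)))
    (complex.Re (\tr (K *m mx_partial i A u))).
Proof.
have -> : (fun v => complex.Re (\tr (K *m A v))) =
  \sum_a \sum_b ((complex.Re (K a b) \*: (fun v => complex.Re (A v b a))) -
                 (complex.Im (K a b) \*: (fun v => complex.Im (A v b a)))).
  apply/funext => v; rewrite Re_mxtrace_mul fct_sumE; apply: eq_bigr => a _.
  by rewrite fct_sumE; apply: eq_bigr => b _.
rewrite Re_mxtrace_mul.
apply: is_derive_sum => a; apply: is_derive_sum => b.
have [dRe dIm] := coord_smooth hA b a.
rewrite mxE; apply: is_deriveB; apply: is_deriveZ; apply: derivableP.
  (* The empty list of partial derivatives gives differentiability of the entry itself. *)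
  exact: (diff_derivable (dRe [::] u hu)).
exact: (diff_derivable (dIm [::] u hu)).
Qed.

(** As [Theta] is open, [A v] is Hermitian for all [v] near [u], so the symmetry of the entries can
    be differentiated. *)
Lemma mx_partial_adj i : (mx_partial i A u)^t* = mx_partial i A u.
Proof.
have AE a b : \forall v \near u, A v a b = Num.conj (A v b a).
  near=> v; have Tv : Theta v by near: v; exact: near_coord_domain.
  by rewrite -[in LHS](posdefmx_adj (coord_posdef hA Tv)) !mxE.
apply/matrixP => a b; rewrite !mxE; apply/eqP.
rewrite /Num.conj /= eq_complex /=; apply/andP; split; apply/eqP.
  apply: near_eq_derive; near=> v.
  have -> : A v b a = Num.conj (A v a b) by near: v; exact: AE.
  by case: (A v a b).
rewrite -deriveN; last first.
  have [_ dIm] := coord_smooth hA b a.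
  exact: (diff_derivable (dIm [::] u hu)).
apply: near_eq_derive; near=> v.
have -> : A v a b = Num.conj (A v b a) by near: v; exact: AE.
rewrite -[LHS]/(- complex.Im (A v b a)).
by case: (A v b a).
Unshelve. all: by end_near. Qed.

Lemma metric_matrixE i j : (metric_matrix A u i j)%:C =
  \tr (invmx (A u) *m mx_partial i A u *m invmx (A u) *m mx_partial j A u).
Proof.
rewrite mxE riem_metricE ?mx_partial_adj //.
exact: posdefmx_adj (coord_posdef hA hu).
Qed.

(** If [c G = 0], the tangent vector [X] with coefficients [c] satisfies [g(X, X) = c G c^T = 0].
    Definiteness gives [X = 0], and the immersion property gives [c = 0]. *)
Lemma metric_matrix_unit : metric_matrix A u \in unitmx.
Proof.
rewrite -row_free_unit; apply/inj_row_free => c cG.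
pose X : 'M[R[i]]_n := \sum_i (c 0 i)%:C *: mx_partial i A u.
have XX : X^t* = X.
  rewrite /X raddf_sum [LHS]raddf_sum; apply: eq_bigr => i _ /=.
  by rewrite -[LHS]/((_ *: _)^t*) adjmxZ_real mx_partial_adj.
have XE : (riem_metric (A u) X X)%:C =
    ((c *m metric_matrix A u *m c^T) 0 0)%:C.
  rewrite riem_metricE //; last exact: posdefmx_adj (coord_posdef hA hu).
  rewrite {2}/X mulmx_sumr raddf_sum mxE realC_sum; apply: eq_bigr => j _ /=.
  rewrite -scalemxAr linearZ /= mulrC realCM mxE [c^T _ _]mxE; congr (_ * _).
  rewrite /X realC_sum mulmx_sumr !mulmx_suml raddf_sum.
  apply: eq_bigr => i _ /=; rewrite -scalemxAr -!scalemxAl linearZ /=.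
  by rewrite realCM metric_matrixE.
have X0 : X = 0.
  apply: (riem_metric_eq0 (coord_posdef hA hu) XX); apply: complexI.
  by rewrite XE cG mul0mx mxE.
apply/rowP => i; rewrite [RHS]mxE.
exact: (coord_immersion hA hu X0).
Qed.

Lemma is_derive_sqr_sub i (K : 'M[R[i]]_n) :
  is_derive u (delta_mx i 0) (fun v =>
    (complex.Re (\tr (K *m A v)) - complex.Re (\tr (K *m A u))) ^+ 2) 0.
Proof.
have dK := is_derive_Re_mxtrace i K.
pose g v := complex.Re (\tr (K *m A v)).
have -> : (fun v => (complex.Re (\tr (K *m A v)) -
    complex.Re (\tr (K *m A u))) ^+ 2) = (g - cst (g u)) ^+ 2.
  by apply/funext => v; rewrite !expr2.
have dg : is_derive u (delta_mx i 0) (g - cst (g u))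
    (complex.Re (\tr (K *m mx_partial i A u)) - 0) by exact: is_deriveB.
apply: (is_derive_eq (is_deriveX 2 dg)).
by rewrite -[(g - cst (g u)) u]/(g u - g u) subrr expr1 mulr0 scale0r.
Qed.

(** This provides the error term [q] of [is_derive_squeeze]. The adjoint in the second factor makes
    it a sum of squares at every [v], also outside [Theta], and each square is that of a function
    vanishing at [u]. *)
Lemma is_derive_congr_sqr i (L : 'M[R[i]]_n) :
  is_derive u (delta_mx i 0) (fun v =>
    complex.Re (\tr ((L *m A v *m L - L *m A u *m L) *m
                     (L *m A v *m L - L *m A u *m L)^t*))) 0.
Proof.
pose K a b : 'M[R[i]]_n := L *m delta_mx b a *m L.
(* Since [Re (- i z) = Im z], this matrix extracts the imaginary part of the entry whose real part
   comes from [K a b]. *)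
pose K' a b : 'M[R[i]]_n := - 'i%C *: K a b.
have KE a b v : \tr (K a b *m A v) = (L *m A v *m L) a b.
  by rewrite -[RHS]mxtrace_delta_mul mxtrace_mul_conj.
pose sq (K0 : 'M[R[i]]_n) v :=
  (complex.Re (\tr (K0 *m A v)) - complex.Re (\tr (K0 *m A u))) ^+ 2.
have -> : (fun v => complex.Re (\tr ((L *m A v *m L - L *m A u *m L) *m
    (L *m A v *m L - L *m A u *m L)^t*))) =
    \sum_a \sum_b (sq (K a b) + sq (K' a b)).
  apply/funext => v; rewrite mxtrace_mul_adj fct_sumE; apply: eq_bigr => a _.
  rewrite fct_sumE; apply: eq_bigr => b _.
  rewrite -[RHS]/(sq (K a b) v + sq (K' a b) v) /sq /K' -!scalemxAl !linearZ /=.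
  rewrite !KE !mxE; move: (\sum_(_ < _) _) (\sum_(_ < _) _) => [x y] [x' y'] /=.
  by rewrite !(mulr1, mul0r, mulr0, oppr0, mulN1r, mul1r, opprK, sub0r, add0r).
have sum0 : \sum_(a < n) (0 : R) = 0 by rewrite big1.
rewrite -[X in is_derive _ _ _ X]sum0.
apply: is_derive_sum => a.
rewrite -[X in is_derive _ _ _ X]sum0.
apply: is_derive_sum => b; rewrite -[X in is_derive _ _ _ X]addr0.
by apply: is_deriveD; exact: is_derive_sqr_sub.
Qed.

(** By [is_derive_squeeze], [J] has the derivative of its linearization at [C = T A(u) T], a real
    linear function of [A v]; the error is controlled by the squared Frobenius norm of
    [T (A v - A u) T]. *)
Lemma is_derive_sq_dist_cost i (B : 'M[R[i]]_n) (T := invmx (herm_sqrt B)) :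
  posdefmx B ->
  is_derive u (delta_mx i 0) (sq_dist_cost A B)
    (complex.Re (\tr ((T *m herm_fun (fun x => 2 * ln x / x) (T *m A u *m T)
                      *m T) *m mx_partial i A u))).
Proof.
move=> Bp; have [Su _] := herm_sqrt_posdef Bp.
have Tu : T \in unitmx by rewrite unitmx_inv.
have Th : T^t* = T by rewrite adjmxV; congr invmx; exact: herm_fun_adj.
have Cp v : Theta v -> posdefmx (T *m A v *m T).
  by move=> Tv; exact: (posdefmx_congr Tu Th (coord_posdef hA Tv)).
have [d d0 [K rem]] := mxtrace_ln_sqr_remainder (Cp u hu).
apply: (is_derive_squeeze (is_derive_Re_mxtrace i _)
  (is_derive_congr_sqr i T) _ d0 (K := K)).
  by rewrite subrr mul0mx mxtrace0.
near=> v; have Tv : Theta v by near: v; exact: near_coord_domain.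
have Jv w : Theta w -> sq_dist_cost A B w =
    complex.Re (\tr (herm_fun (fun x => ln x ^+ 2) (T *m A w *m T))).
  by move=> Tw; rewrite -(geodesic_dist_sqr (coord_posdef hA Tw) Bp).
have adjC w : Theta w -> (T *m A w *m T)^t* = T *m A w *m T.
  by move=> /Cp/posdefmx_adj.
have -> : (T *m A v *m T - T *m A u *m T)^t* = T *m A v *m T - T *m A u *m T.
  by rewrite [LHS]adjmxB; congr (_ - _); exact: adjC.
move=> /(rem _ (adjC v Tv)); apply: le_trans.
rewrite !Jv // le_eqVlt; apply/orP; left; apply/eqP; congr `|_|.
have ReB : {morph @complex.Re R : x y / x - y} by case=> ? ? [].
(* Cyclicity of the trace moves the outer factors [T] from [A] onto the functional-calculus
   factor. *)
rewrite -!ReB; congr (complex.Re (_ - _)); rewrite mulmxBr raddfB /=.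
by rewrite !mxtrace_mul_conj.
Unshelve. all: by end_near. Qed.

End CoordinateDerivatives.

(** * The gradient formula *)

Lemma herm_fun_ln_div (R : realType) (n : nat) (X : 'M[R[i]]_n) :
  posdefmx X -> herm_fun (fun x => 2 * ln x / x) X = 2 *: (herm_ln X *m invmx X).
Proof.
move=> Xp; have [_ ->] := posdefmx_unit Xp; rewrite herm_funM.
have -> : 2 = 2%:C :> R[i] by rewrite rmorph_nat.
by rewrite -herm_funZ; apply: eq_herm_fun => i; rewrite mulrA.
Qed.

Theorem theorem3p4 (R : realType) (n m : nat)
  (Theta : set 'cV[R]_m) (A : 'cV[R]_m -> 'M[R[i]]_n) (B : 'M[R[i]]_n)
  (hA : coordinate_submanifold Theta A) (hB : posdefmx B)
  (eta : nat -> R) (u : nat -> 'cV[R]_m) (hu : forall k, Theta (u k)) :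
  let J := sq_dist_cost A B in
  let G := metric_matrix A in
  let sB := herm_sqrt B in
  [/\ forall k, G (u k) \in unitmx /\
        forall i j, (G (u k) i j)%:C =
          \tr (invmx (A (u k)) *m mx_partial i A (u k) *m
               invmx (A (u k)) *m mx_partial j A (u k)),
      natural_gradient_descent G J eta u <->
        forall k, u k.+1 = u k - eta k *:
                    (invmx (G (u k)) *m \col_i partial i J (u k)) &
      forall k i,
        derivable J (u k) (delta_mx i 0) /\
        (partial i J (u k))%:C =
          2 * \tr (invmx sB *m herm_ln (invmx sB *m A (u k) *m invmx sB) *m sB *m
                   invmx (A (u k)) *m mx_partial i A (u k))].
Proof.
(* The middle clause closes by unfolding the definitions of the descent and of the gradient. *)
move=> J G sB; split=> // k.
  split; first exact: metric_matrix_unit hA (hu k).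
  by move=> i j; exact: metric_matrixE hA (hu k) i j.
move=> i; set T := invmx sB; set C := T *m A (u k) *m T.
have [dJ JE] := is_derive_sq_dist_cost hA (hu k) i hB.
split=> //; rewrite /partial JE -/T -/C.
have [Su _] := herm_sqrt_posdef hB.
have Ap := coord_posdef hA (hu k).
have Tu : T \in unitmx by rewrite unitmx_inv.
have Th : T^t* = T by rewrite adjmxV; congr invmx; exact: herm_fun_adj.
have Cp : posdefmx C by exact: (posdefmx_congr Tu Th Ap).
have [Au _] := posdefmx_unit Ap.
(* This turns the symmetric product [T (ln C) C^-1 T] into [B^-1/2 (ln C) B^1/2 A^-1]. *)
have CV : invmx C *m T = sB *m invmx (A (u k)).
  by rewrite (invmx_congr Su Au) mulmxK.
have Kh : (T *m herm_fun (fun x => 2 * ln x / x) C *m T)^t* =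
    T *m herm_fun (fun x => 2 * ln x / x) C *m T.
  by rewrite adjmxM [X in _ *m X]adjmxM Th herm_fun_adj mulmxA.
rewrite -(mxtrace_herm_real Kh (mx_partial_adj hA (hu k) i)).
rewrite (herm_fun_ln_div Cp) -scalemxAr -!scalemxAl linearZ /=; congr (_ * \tr _).
move: (herm_ln C) (invmx C) CV => L CI CV.
by rewrite -[_ *m sB *m _]mulmxA -CV !mulmxA.
Qed.
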